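(* Let $p$ be a prime and let $G$ be a finite $p$-group of nilpotency class $2$. Then for any group word $w$, $P(G,w)\geq\frac{1}{|G|}$.
   Context: A group word $w=w(x_1,\dots,x_n)$ in $n$ variables is an element of the free group $F_n$ on $x_1,\dots,x_n$; for a group $G$ and $\mathbf{g}=(g_1,\dots,g_n)\in G^{(n)}$ (the set of $n$-tuples of elements of $G$), $w(\mathbf{g})\in G$ is the element obtained by substituting $g_i$ for $x_i$. For a finite group $G$, $P(G,w)=\dfrac{|\{\mathbf{g}\in G^{(n)} : w(\mathbf{g})=1\}|}{|G|^n}$ is the probability that a random $n$-tuple of elements of $G$ satisfies $w$. *)

(* Defs.v *)
From HB Require Import structures.
From mathcomp Require Import all_boot all_order all_algebra all_fingroup.
From mathcomp Require Import all_solvable.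
Set Implicit Arguments.
Unset Strict Implicit.
Unset Printing Implicit Defensive.
Import GroupScope.

(* The free group on T is realised by its normal forms: sequences of letters
   x^{+1} = (x, false) and x^{-1} = (x, true) in which no letter is immediately
   followed by its inverse.  Products are computed by pushing the letters of
   the left factor one by one, with cancellation, in front of the right one. *)
Section FreeGroup.
Variable T : choiceType.
Implicit Types (a b : T * bool) (s t : seq (T * bool)).

Definition linv a : T * bool := (a.1, ~~ a.2).

Definition reduced s : bool := sorted (fun a b => b != linv a) s.

Definition push a s : seq (T * bool) :=
  if s is b :: s' then if b == linv a then s' else a :: s else [:: a].

Record free_group : Type := FreeWord { word : seq (T * bool); _ : reduced word }.

HB.instance Definition _ := [isSub for word].
HB.instance Definition _ := [Choice of free_group by <:].

Lemma linvK : involutive linv.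
Proof. by case=> x e; rewrite /linv /= negbK. Qed.

Lemma reduced_push a s : reduced s -> reduced (push a s).
Proof.
case: s => [|b s] //= s_red; case: ifPn => [_|ba]; first exact: path_sorted s_red.
by rewrite /reduced /= ba.
Qed.

Lemma reduced_foldr s t : reduced t -> reduced (foldr push t s).
Proof. by move=> t_red; elim: s => //= a s; apply: reduced_push. Qed.

Lemma pushK a s : reduced s -> push (linv a) (push a s) = s.
Proof.
case: s => [|b s] /= s_red; first by rewrite linvK eqxx.
case: ifPn => [/eqP ba|_] /=; last by rewrite linvK eqxx.
case: s s_red => [|c s] /=; first by rewrite ba.
by rewrite ba linvK; case/andP=> /negPf ->.
Qed.

Lemma foldr_push a s t : reduced t ->
  foldr push t (push a s) = push a (foldr push t s).
Proof.
move=> t_red; case: s => [|b s] //=; case: ifP => // /eqP -> /=.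
by have := pushK (linv a) (reduced_foldr s t_red); rewrite linvK.
Qed.

Lemma foldr_push_nil s : reduced s -> foldr push [::] s = s.
Proof.
elim: s => // a s IHs /= as_red; rewrite IHs; last exact: path_sorted as_red.
by case: s as_red {IHs} => //= b s /andP[/negPf ->].
Qed.

Lemma reduced_inv s : reduced s -> reduced (rev (map linv s)).
Proof.
rewrite /reduced rev_sorted sorted_map; apply: sub_sorted => a b /=.
by rewrite (inj_eq (inv_inj linvK)); apply: contra => /eqP ->; rewrite linvK.
Qed.

Lemma foldr_invl s t : reduced t ->
  foldr push (foldr push t s) (rev (map linv s)) = t.
Proof.
move=> t_red; elim: s => //= a s IHs; rewrite rev_cons -cats1 foldr_cat /=.
by rewrite pushK ?reduced_foldr.
Qed.

Definition free_one : free_group := @FreeWord [::] isT.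
Definition free_mul (u v : free_group) : free_group :=
  FreeWord (reduced_foldr (word u) (valP v)).
Definition free_inv (u : free_group) : free_group :=
  FreeWord (reduced_inv (valP u)).

Lemma free_mulA : associative free_mul.
Proof.
move=> u v w; apply: val_inj => /=; have w_red := valP w.
by elim: (word u) => //= a s ->; rewrite foldr_push.
Qed.
Lemma free_mul1 : left_id free_one free_mul.
Proof. by move=> u; apply: val_inj. Qed.
Lemma free_mulr1 : right_id free_one free_mul.
Proof. by move=> u; apply: val_inj; apply: foldr_push_nil (valP u). Qed.
Lemma free_mulV : left_inverse free_one free_inv free_mul.
Proof.
move=> u; apply: val_inj => /=.
by rewrite -{1}(foldr_push_nil (valP u)) foldr_invl.
Qed.
Lemma free_invK : involutive free_inv.
Proof.
by move=> u; apply: val_inj; rewrite /= map_rev revK mapK //; apply: linvK.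
Qed.
Lemma free_mulrV : right_inverse free_one free_inv free_mul.
Proof. by move=> u; rewrite -{1}[u]free_invK free_mulV. Qed.

HB.instance Definition _ := isGroup.Build free_group
  free_mulA free_mul1 free_mulr1 free_mulV free_mulrV.

Definition free_gen (x : T) : free_group := @FreeWord [:: (x, false)] isT.

Section Substitution.
Variables (H : groupType) (g : T -> H).

Definition letter_val a : H := if a.2 then (g a.1)^-1 else g a.1.

Definition word_val (w : free_group) : H := \prod_(a <- word w) letter_val a.

Lemma letter_valV a : letter_val (linv a) = (letter_val a)^-1.
Proof. by case: a => x [] /=; rewrite /letter_val /= ?invgK. Qed.

(* word_val is the group morphism given by the universal property of the free
   group: word_val_gen, word_valM and word_val_unique below. *)
Lemma word_val_gen x : word_val (free_gen x) = g x.
Proof. by rewrite /word_val big_seq1. Qed.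

Lemma word_valM : {morph word_val : u v / u * v}.
Proof.
move=> u v; rewrite /word_val /=.
elim: (word u) => [|a s IHs] /=; first by rewrite big_nil mul1g.
rewrite big_cons -mulgA -IHs; case: (foldr _ _ _) => [|b t] /=.
  by rewrite big_seq1 big_nil mulg1.
by case: ifP => [/eqP->|_]; rewrite !big_cons // letter_valV mulKVg.
Qed.

Lemma word_val_unique (h : free_group -> H) : {morph h : u v / u * v} ->
  (forall x, h (free_gen x) = g x) -> h =1 word_val.
Proof.
move=> hM h_gen u.
have h1 : h 1 = 1 by apply: (mulgI (h 1)); rewrite -hM !mulg1.
have hV v : h v^-1 = (h v)^-1.
  by apply: (mulgI (h v)); rewrite -hM !mulgV h1.
case: u; elim=> [|a s IHs] s_red.
  rewrite /word_val big_nil -h1; congr h; exact: val_inj.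
have s_red' : reduced s by apply: path_sorted s_red.
pose A : free_group := if a.2 then (free_gen a.1)^-1 else free_gen a.1.
have defs : FreeWord s_red = A * FreeWord s_red'.
  apply: val_inj; case: a s_red @A => x e s_red /=.
  by case: e s_red; case: s {IHs s_red'} => //= b s /andP[/negPf ->].
rewrite {1}defs hM IHs /word_val big_cons; congr (_ * _).
by rewrite /A /letter_val; case: ifP => _; rewrite ?hV h_gen.
Qed.

End Substitution.
End FreeGroup.

Definition word_sols (gT : finGroupType) (G : {set gT}) (n : nat)
    (w : free_group 'I_n) : {set {ffun 'I_n -> gT}} :=
  [set g in ffun_on (mem G) | word_val g w == 1].

Definition word_prob (gT : finGroupType) (G : {set gT}) (n : nat)
    (w : free_group 'I_n) : rat :=
  (#|word_sols G w|%:R / (#|G|%:R ^+ n))%R.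

(* Main.v *)
From HB Require Import structures.
Require Import Defs.
From mathcomp Require Import all_boot all_order all_algebra all_fingroup.
From mathcomp Require Import all_solvable.
Set Implicit Arguments.
Unset Strict Implicit.
Unset Printing Implicit Defensive.
Import GRing.Theory Num.Theory.

(** Why the theorem is true.  Write [|G| = N], a power of [p], and count the
    tuples solving [w]: at least [|G|^(n-1)] of them are needed.

    In class 2 the commutator map is a bilinear alternating map with values in
    the centre, so every word map equals [g_1^a_1 ... g_n^a_n] times a central
    factor [Q(g)], a product of powers of the commutators [[g_i, g_j]]
    ([normal_form_word]).  Since [N] is a prime power, divisibility modulo [N]
    is total, hence some exponent [a_i0] divides all the others modulo [N].
    Replacing [g_i0] by [v u(g)], with [v] central and [u(g)] a suitable product
    of powers of the other variables, makes the exponent sums of the other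
    variables vanish and turns the word into [v^a_i0 Q'(g)] with [Q'] of the
    same kind as [Q].  It therefore suffices to find many pairs [(v, g)] with
    [v^a_i0 Q'(g) = 1]; this is done in [word_solutions_bound].

    The heart of the matter is [comm_form_zeros]: for every homomorphism [L]
    from a finite group [Y] to the centre [V], the equation [L(y) + Q(g) = 0]
    has at least its fair share [|Y| |G|^n / |V|] of solutions.  When [Q = 0]
    this is the size of a kernel ([card_le_kernel]).  Otherwise take a
    commutator [[g_i, g_j]] whose exponent [d] divides all the other exponents
    modulo [N]; translations of [g_i] and [g_j] by products of the remaining
    variables absorb all the commutators that involve [i] or [j], as when a
    hyperbolic plane is split off an alternating form ([comm_form_pivot]), so
    that [Q(g) = d b(x, x') + Q'(rest)].  For each fixed [x], the map
    [(y, x') |-> L(y) + d b(x, x')] is again a homomorphism, now on [Y * G],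
    and the bound for [Q'], which has two variables less, applies to it.
    Letting [L] range over all homomorphisms is what makes this induction
    close up, with no need for a normal form of alternating matrices. *)

(** * Divisibility modulo a prime power *)

Lemma modn_mul_of_dvd_gcd N d s :
  0 < N -> gcdn d N %| s -> exists t, s = t * d %[mod N].
Proof.
move=> N0 /dvdnP[q ->]; have [a _ ha] := Bezoutr d N0.
(* Bezout gives [gcdn d N = - a * d] modulo [N]; [N.-1] plays the part of -1. *)
exists (q * a * N.-1).
apply/eqP; rewrite -(eqn_modDr (q * a * d)).
have -> : q * gcdn d N + q * a * d = q * (gcdn d N + a * d).
  by rewrite mulnDr mulnA.
have -> : q * a * N.-1 * d + q * a * d = q * a * d * N.
  by rewrite -{2}(prednK N0) mulnS addnC [(_ * N.-1 * d)%N]mulnAC.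
by rewrite modnMl; have := dvdn_mull q ha.
Qed.

(** Modulo a prime power, divisibility is a total preorder, so a nonempty finite
    family has a member that divides all the others; the one whose gcd with
    [p ^ e] is least will do. *)
Lemma minimal_pivot p e (T : finType) (P : pred T) (F : T -> nat) k0 :
  prime p -> P k0 ->
  exists2 i, P i & forall k, P k -> exists t, F k = t * F i %[mod p ^ e].
Proof.
move=> p_pr Pk0; have N0 : 0 < p ^ e by rewrite expn_gt0 prime_gt0.
case: (arg_minnP (fun k => gcdn (F k) (p ^ e)) Pk0) => i Pi min_i.
exists i => // k Pk; apply: modn_mul_of_dvd_gcd => //.
apply: dvdn_trans (dvdn_gcdl _ (p ^ e)); have := min_i k Pk.
have /(dvdn_pfactor _ _ p_pr)[m _ ->] := dvdn_gcdr (F i) (p ^ e).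
have /(dvdn_pfactor _ _ p_pr)[l _ ->] := dvdn_gcdr (F k) (p ^ e).
by rewrite leq_exp2l ?prime_gt1 //; apply: dvdn_exp2l.
Qed.

(** * Two counting tools *)

Section Resample.
Variables (I X : finType).
Implicit Types (g : {ffun I -> X}).

Definition update g i x : {ffun I -> X} :=
  [ffun k => if k == i then x else g k].

(** Drawing one coordinate afresh does not change the uniform distribution:
    this frees a variable without splitting it off the tuple. *)
Lemma sum_update i (F : {ffun I -> X} -> nat) :
  \sum_g \sum_x F (update g i x) = #|X| * \sum_g F g.
Proof.
have -> : #|X| * \sum_g F g = \sum_g \sum_(x : X) F g.
  by rewrite big_distrr /=; apply: eq_bigr => g _; rewrite sum_nat_const.
rewrite !pair_bigA /=.
pose h (u : {ffun I -> X} * X) := (update u.1 i u.2, u.1 i).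
have hK : involutive h.
  case=> g x; rewrite /h /= ffunE eqxx; congr (_, _).
  by apply/ffunP=> k; rewrite !ffunE; case: eqP => // ->.
rewrite (reindex_inj (inv_inj hK)) /=; apply: eq_bigr => u _.
by congr (F _); exact: (congr1 fst (hK u)).
Qed.
End Resample.

(** Every fibre of a homomorphism is empty or a translate of its kernel. *)
Lemma card_le_kernel (Y : finGroupType) (V : finZmodType) (L : Y -> V) :
  {morph L : x y / (x * y)%g >-> (x + y)%R} ->
  #|Y| <= #|V| * \sum_y (L y == 0%R).
Proof.
move=> LM.
have -> : \sum_y (L y == 0%R) = #|[set y | L y == 0%R]|.
  by rewrite -sum1dep_card [RHS]big_mkcond; apply: eq_bigr => y _; case: eqP.
rewrite -cardsT -sum1_card (partition_big L predT) //= -sum_nat_const.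
apply: leq_sum => v _; rewrite sum1dep_card.
have [-> | [y0]] := set_0Vmem [set y | (y \in setT) && (L y == v)].
  by rewrite cards0.
rewrite !inE /= => /eqP Ly0.
rewrite -[leqRHS](card_imset _ (mulgI y0)) subset_leq_card //.
apply/subsetP=> y; rewrite !inE /= => /eqP Ly.
apply/imsetP; exists (y0^-1 * y)%g; last by rewrite mulKVg.
by rewrite inE; apply/eqP/(@addrI _ (L y0)); rewrite -LM mulKVg addr0 Ly.
Qed.

(** * Zeros of alternating forms *)

Section CommutatorForms.
Local Open Scope ring_scope.
Variables (I : finType) (X : finGroupType) (V : finZmodType).
Variables (b : X -> X -> V).
Hypothesis bMl : forall z, {morph b^~ z : x y / (x * y)%g >-> x + y}.
Hypothesis bxx : forall x, b x x = 0.
Hypothesis bMr : forall z, {morph b z : x y / (x * y)%g >-> x + y}.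
Variables (p e : nat).
Hypothesis p_pr : prime p.
Let N := (p ^ e)%N.
Hypothesis V_exp : forall v : V, v *+ N = 0.
Implicit Types (A : {set I}) (c : I -> I -> nat) (g : I -> X).

Lemma b1l x : b 1%g x = 0.
Proof. by apply: (@addrI _ (b 1%g x)); rewrite -bMl mulg1 addr0. Qed.
Lemma b1r x : b x 1%g = 0.
Proof. by apply: (@addrI _ (b x 1%g)); rewrite -bMr mulg1 addr0. Qed.
Lemma bVl x y : b x^-1%g y = - b x y.
Proof. by apply: (@addrI _ (b x y)); rewrite -bMl mulgV b1l subrr. Qed.
Lemma bC x y : b x y = - b y x.
Proof.
have := bxx (x * y); rewrite bMl !bMr !bxx add0r addr0 => /eqP.
by rewrite addr_eq0 => /eqP.
Qed.
Lemma bXl x y k : b (x ^+ k)%g y = b x y *+ k.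
Proof. by elim: k => [|k IH]; rewrite ?b1l // expgS bMl IH mulrS. Qed.
Lemma bXr x y k : b y (x ^+ k)%g = b y x *+ k.
Proof. by elim: k => [|k IH]; rewrite ?b1r // expgS bMr IH mulrS. Qed.
Lemma b_prodl (P : pred I) F y :
  b (\prod_(k | P k) F k)%g y = \sum_(k | P k) b (F k) y.
Proof. exact: (big_morph (b^~ y) (bMl y) (b1l y)). Qed.
Lemma b_prodr (P : pred I) F y :
  b y (\prod_(k | P k) F k)%g = \sum_(k | P k) b y (F k).
Proof. exact: (big_morph (b y) (bMr y) (b1r y)). Qed.

Lemma mulrn_congr (v : V) m n : m = n %[mod N] -> v *+ m = v *+ n.
Proof.
move=> E; rewrite (divn_eq m N) (divn_eq n N) E !mulrnDr.
by rewrite ![(_ %/ _ * _)%N]mulnC !mulrnA !V_exp !mul0rn.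
Qed.

Lemma mulrn_pred (v : V) m : v *+ (m * N.-1) = - (v *+ m).
Proof.
have N0 : (0 < N)%N by rewrite expn_gt0 prime_gt0.
apply: (@addrI _ (v *+ m)); rewrite subrr -mulrnDr -{1}[m]muln1 -mulnDr.
by rewrite add1n prednK // mulnC mulrnA V_exp mul0rn.
Qed.

Definition comm_form A c g : V :=
  \sum_(i in A) \sum_(j in A) b (g i) (g j) *+ c i j.

(** The exponent of [b (g i) (g j)] once the term in [b (g j) (g i)] has been
    merged into it; [N.-1] stands for -1 so that exponents stay natural. *)
Definition net c i j := (c i j + c j i * N.-1)%N.

Lemma net_mul c i j x y : b x y *+ net c i j = b x y *+ c i j + b y x *+ c j i.
Proof. by rewrite mulrnDr mulrn_pred (bC y x) mulNrn. Qed.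

Lemma comm_form_update2 A c (i j : I) (g : {ffun I -> X}) x y :
    i \in A -> j \in A -> i != j ->
  let A' := A :\ i :\ j in
  comm_form A c (update (update g j y) i x) =
    b x y *+ net c i j + (\sum_(k in A') b x (g k) *+ net c i k
       + \sum_(k in A') b y (g k) *+ net c j k) + comm_form A' c g.
Proof.
move=> Ai Aj ij A'; set h := update _ _ _.
have hi : h i = x by rewrite !ffunE eqxx.
have hj : h j = y by rewrite !ffunE eq_sym (negPf ij) eqxx.
have hk k : k \in A' -> h k = g k.
  by rewrite !inE !ffunE => /and3P[/negPf-> /negPf-> _].
have Aji : j \in A :\ i by rewrite !inE eq_sym ij.
have split2 (F : I -> V) : \sum_(k in A) F k = F i + F j + \sum_(k in A') F k.
  by rewrite (big_setD1 i Ai) /= (big_setD1 j Aji) /= addrA.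
rewrite /comm_form split2 !split2 hi hj !bxx !mul0rn add0r addr0.
have -> : \sum_(k in A') \sum_(l in A) b (h k) (h l) *+ c k l =
   \sum_(k in A') (b (g k) x *+ c k i) + \sum_(k in A') (b (g k) y *+ c k j)
   + comm_form A' c g.
  rewrite -!big_split /=; apply: eq_bigr => k Ak.
  rewrite split2 hi hj hk //; congr (_ + _).
  by apply: eq_bigr => l Al; rewrite hk.
have E z u : \sum_(k in A') b z (g k) *+ net c u k =
   \sum_(k in A') b z (h k) *+ c u k + \sum_(k in A') b (g k) z *+ c k u.
  by rewrite -big_split; apply: eq_bigr => k Ak; rewrite net_mul hk.
rewrite !E net_mul /comm_form.
set S1 := \sum_(k in A') b x _ *+ _; set S2 := \sum_(k in A') b y _ *+ _.
set T1 := \sum_(k in A') b _ x *+ _; set T2 := \sum_(k in A') b _ y *+ _.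
rewrite !addrA; congr (_ + _); rewrite -!addrA; congr (_ + _).
rewrite [in LHS]addrCA; congr (_ + _); congr (_ + _).
by rewrite addrCA.
Qed.

(** If the net exponent [d] at [(i, j)] divides all the others, then modulo [N]
    the terms in [x = g i] read [d b(x, y0)] and those in [y = g j] read
    [d b(y, z)], for products [z] and [y0] of powers of the other variables.
    As [b(x, y) + b(x, y0) + b(y, z) = b(x z^-1, y y0) + b(z, y0)], completing
    the product in this way leaves a form in the other variables only. *)
Lemma comm_form_pivot A c i j :
    i \in A -> j \in A -> i != j ->
    (forall k l, k \in A -> l \in A -> k != l ->
       exists t, net c k l = t * net c i j %[mod N]) ->
  exists c' (z y0 : {ffun I -> X} -> X), forall (g : {ffun I -> X}) x y,
    comm_form A c (update (update g j y) i x) =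
    b (x * (z g)^-1)%g (y * y0 g)%g *+ net c i j + comm_form (A :\ i :\ j) c' g.
Proof.
move=> Ai Aj ij piv; set A' := A :\ i :\ j; set d := net c i j.
have [s Hs] : exists s : I -> nat, forall k, k \in A' ->
    net c i k = (s k * d)%N %[mod N].
  have: forall k, exists t, k \in A' -> net c i k = (t * d)%N %[mod N].
    move=> k; have [|_] := boolP (k \in A'); last by exists 0%N.
    rewrite !inE => /and3P[_ ki Ak].
    by case: (piv i k) => // [|t]; [rewrite eq_sym|exists t].
  by move=> /fin_all_exists.
have [t Ht] : exists t : I -> nat, forall k, k \in A' ->
    net c j k = (t k * d)%N %[mod N].
  have: forall k, exists t, k \in A' -> net c j k = (t * d)%N %[mod N].
    move=> k; have [|_] := boolP (k \in A'); last by exists 0%N.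
    rewrite !inE => /and3P[kj _ Ak].
    by case: (piv j k) => // [|r]; [rewrite eq_sym|exists r].
  by move=> /fin_all_exists.
exists (fun k l => c k l + t k * s l * d)%N.
exists (fun g => \prod_(k in A') (g k ^+ t k))%g.
exists (fun g => \prod_(k in A') (g k ^+ s k))%g.
move=> g x y; rewrite comm_form_update2 //= -/A' -/d.
set z := (\prod_(k in A') (_ ^+ t k))%g.
set y0 := (\prod_(k in A') (_ ^+ s k))%g.
have Ex : \sum_(k in A') b x (g k) *+ net c i k = b x y0 *+ d.
  rewrite b_prodr -sumrMnl; apply: eq_bigr => k Ak.
  by rewrite (mulrn_congr _ (Hs k Ak)) bXr mulrnA.
have Ey : \sum_(k in A') b y (g k) *+ net c j k = - (b z y *+ d).
  rewrite -mulNrn -bC b_prodr -sumrMnl; apply: eq_bigr => k Ak.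
  by rewrite (mulrn_congr _ (Ht k Ak)) bXr mulrnA.
have Ec : comm_form A' (fun k l => c k l + t k * s l * d)%N g =
   b z y0 *+ d + comm_form A' c g.
  rewrite b_prodl -sumrMnl -big_split /=; apply: eq_bigr => k Ak.
  rewrite b_prodr -sumrMnl -big_split /=; apply: eq_bigr => l Al.
  by rewrite bXl bXr mulrnDr addrC !mulrnA [_ *+ t k *+ s l]mulrnAC.
rewrite Ex Ey Ec !bMl !bMr !bVl !mulrnDl !mulNrn !addrA; congr (_ + _).
by rewrite subrK.
Qed.

(** Induction on [#|A|], two variables at a time.  Quantifying over all [Y] and
    [L] lets the variable that occurs linearly after [comm_form_pivot] migrate
    into the homomorphism, its companion [x] being fixed. *)
Lemma comm_form_zeros A c (Y : finGroupType) (L : Y -> V) :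
    {morph L : x y / (x * y)%g >-> x + y} ->
  (#|Y| * #|X| ^ #|I| <=
     #|V| * \sum_(y : Y) \sum_(g : {ffun I -> X})
              (L y + comm_form A c g == 0)%R)%N.
Proof.
have X0 : (0 < #|X|)%N by apply/card_gt0P; exists 1%g.
have [n] := ubnP #|A|; elim: n => // n IH in A c Y L *; rewrite ltnS => leA LM.
have [/exists_inP[i0 i0A /exists_inP[j0 j0A ij0]]|] :=
  boolP [exists i in A, exists j in A, i != j]; last first.
  (* At most one variable is left, and [b] is alternating. *)
  move=> /exists_inPn A1.
  have Q0 g : comm_form A c g = 0.
    rewrite /comm_form big1 // => i iA; rewrite big1 // => j jA.
    have /exists_inPn/(_ j jA) := A1 i iA; rewrite negbK => /eqP->.
    by rewrite bxx mul0rn.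
  under eq_bigr => y _.
    under eq_bigr => g _ do rewrite Q0 addr0.
    rewrite sum_nat_const card_ffun mulnC; over.
  by rewrite -big_distrl mulnA leq_mul2r card_le_kernel ?orbT.
have [[i j] /= /and3P[iA jA ij] piv] := @minimal_pivot p e (I * I)%type
  [pred u | [&& u.1 \in A, u.2 \in A & u.1 != u.2]]
  (fun u => net c u.1 u.2) (i0, j0) p_pr (introT and3P (And3 i0A j0A ij0)).
have [|c' [z [y0 E]]] := @comm_form_pivot A c i j iA jA ij.
  by move=> k l kA lA kl; apply: (piv (k, l)); rewrite /= kA lA.
pose d := net c i j; pose A' := A :\ i :\ j.
rewrite -(@leq_pmul2l (#|X| * #|X|)) ?muln_gt0 ?X0 //.
(* The coordinates [i] and [j] are drawn afresh and then translated. *)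
have -> : (#|X| * #|X| * (#|V| * \sum_(y : Y) \sum_(g : {ffun I -> X})
                                   (L y + comm_form A c g == 0)%R) =
   \sum_(x : X) #|V| * \sum_(u : Y * X) \sum_(g : {ffun I -> X})
     ((L u.1 + b x u.2 *+ d) + comm_form A' c' g == 0)%R)%N.
  rewrite mulnCA -big_distrr /=; congr (_ * _)%N.
  rewrite big_distrr /=.
  transitivity (\sum_(y : Y) \sum_(x : X) \sum_(x' : X)
     \sum_(g : {ffun I -> X})
       ((L y + b x x' *+ d) + comm_form A' c' g == 0)%R)%N; last first.
    by rewrite exchange_big /=; apply: eq_bigr => x _; rewrite pair_bigA.
  apply: eq_bigr => y _; rewrite -mulnA -(sum_update i) -(sum_update j) /=.
  transitivity (\sum_(g : {ffun I -> X}) \sum_(x : X) \sum_(x' : X)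
     ((L y + b x x' *+ d) + comm_form A' c' g == 0)%R)%N; last first.
    rewrite exchange_big /=; apply: eq_bigr => x _; exact: exchange_big.
  apply: eq_bigr => g _; rewrite exchange_big /= (reindex_inj (mulIg (z g))) /=.
  apply: eq_bigr => x _; rewrite (reindex_inj (mulIg (y0 g)^-1%g)) /=.
  by apply: eq_bigr => x' _; rewrite E mulgK mulgKV addrA.
have ltA : (#|A'| < n)%N.
  apply: leq_trans leA; rewrite (cardsD1 i A) iA ltnS /A' subset_leq_card //.
  exact: subsetDl.
rewrite -mulnA -[leqLHS]sum_nat_const.
apply: leq_sum => x _; rewrite mulnA [(#|X| * #|Y|)%N]mulnC -card_prod.
apply: (IH A' c' (Y * X)%type) => // -[u1 u2] [v1 v2] /=.
by rewrite LM bMr mulrnDl !addrA; congr (_ + _); rewrite addrAC.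
Qed.

End CommutatorForms.

(** * The centre as an additive group *)

(** An additive copy of the centre, so that sums of commutators may be
    rearranged freely. *)
Definition center_zmod (X : finGroupType) : Type := subg_of 'Z([set: X])%G.

Section CenterZmodule.
Variable X : finGroupType.
Let Z := center_zmod X.
HB.instance Definition _ := Finite.on Z.

Definition in_group (z : Z) : X := sgval z.
Definition to_center (x : X) : Z := subg 'Z([set: X])%G x.

Lemma in_groupP z x : commute (in_group z) x.
Proof. by have /centerP[_ zC] := subgP z; apply: zC; rewrite inE. Qed.

Lemma in_group_inj : injective in_group. Proof. exact: val_inj. Qed.

Lemma to_centerK x : (forall y, commute x y) -> in_group (to_center x) = x.
Proof.
move=> cx; apply: subgK; apply/centerP; split=> [|y _]; first by rewrite inE.
exact: cx.
Qed.

Let zadd (x y : Z) : Z := (x * y)%g.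
Let zopp (x : Z) : Z := (x^-1)%g.
Fact zaddA : associative zadd. Proof. exact: mulgA. Qed.
Fact zaddC : commutative zadd.
Proof. by move=> x y; apply: in_group_inj; apply: in_groupP. Qed.
Fact zadd0 : left_id (1%g : Z) zadd. Proof. exact: mul1g. Qed.
Fact zaddN : left_inverse (1%g : Z) zopp zadd. Proof. exact: mulVg. Qed.
HB.instance Definition _ := GRing.isZmodule.Build Z zaddA zaddC zadd0 zaddN.

Lemma in_groupD : {morph in_group : u v / (u + v)%R >-> (u * v)%g}.
Proof. by []. Qed.
Lemma in_groupMn v m : in_group (v *+ m)%R = (in_group v ^+ m)%g.
Proof. by elim: m => // m IH; rewrite mulrS in_groupD IH expgS. Qed.
End CenterZmodule.

(** * Words in groups of class two *)

Section Words.
Local Open Scope group_scope.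
Variables (X : finGroupType) (I : finType).
Hypothesis class2 : forall x y z : X, commute [~ x, y] z.
Variables (p e : nat).
Hypothesis p_pr : prime p.
Hypothesis cardX : #|X| = (p ^ e)%N.
Let N := (p ^ e)%N.
Let V : finZmodType := center_zmod X.
Implicit Types (g h : I -> X) (s : seq (I * bool)).

Definition commutator (x y : X) : V := to_center [~ x, y].

Lemma commutatorE x y : in_group (commutator x y) = [~ x, y].
Proof. exact: to_centerK. Qed.

Lemma commutatorMl z : {morph commutator^~ z : x y / x * y >-> (x + y)%R}.
Proof.
move=> x y; apply: in_group_inj; rewrite in_groupD !commutatorE commMgJ.
by rewrite conjgE (class2 x z y) mulKg.
Qed.
Lemma commutatorMr z : {morph commutator z : x y / x * y >-> (x + y)%R}.
Proof.
move=> x y; apply: in_group_inj; rewrite in_groupD !commutatorE commgMJ.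
by rewrite conjgE (class2 z x y) mulKg class2.
Qed.
Lemma commutatorxx x : commutator x x = 0%R.
Proof. by apply: in_group_inj; rewrite commutatorE commgg. Qed.

Lemma expgN (x : X) : x ^+ N = 1.
Proof. by rewrite /N -cardX -cardsT expg_cardG ?inE. Qed.

Lemma V_expN (v : V) : (v *+ N = 0)%R.
Proof. by apply: in_group_inj; rewrite in_groupMn expgN. Qed.

Definition formT c g : V := comm_form commutator [set: I] c g.
Definition is_form (f : (I -> X) -> V) := exists c, f =1 formT c.

Lemma formT_sum c g :
  formT c g = (\sum_i \sum_j commutator (g i) (g j) *+ c i j)%R.
Proof.
rewrite /formT /comm_form; apply: eq_big => [i|i _]; rewrite ?inE //.
by apply: eq_bigl => j; rewrite inE.
Qed.

Lemma is_form0 : is_form (fun=> 0%R).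
Proof.
exists (fun _ _ => 0%N) => g; rewrite formT_sum big1 // => i _.
by rewrite big1.
Qed.

Lemma is_formD f1 f2 : is_form f1 -> is_form f2 ->
  is_form (fun g => f1 g + f2 g)%R.
Proof.
move=> [c1 E1] [c2 E2]; exists (fun i j => c1 i j + c2 i j)%N => g.
rewrite E1 E2 !formT_sum -big_split; apply: eq_bigr => i _.
by rewrite -big_split; apply: eq_bigr => j _; rewrite mulrnDr.
Qed.

Lemma is_form_comm i j m :
  is_form (fun g => commutator (g i) (g j) *+ m)%R.
Proof.
exists (fun k l => m * ((k == i) && (l == j)))%N => g; rewrite formT_sum.
rewrite (bigD1 i) //= (bigD1 j) //= !eqxx muln1 !big1 ?addr0 //.
  by move=> k /negPf ki; rewrite big1 // => l _; rewrite ki muln0.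
by move=> k /negPf ki; rewrite ki muln0.
Qed.

Lemma is_form_sum (r : seq I) F : (forall i, is_form (F i)) ->
  is_form (fun g => \sum_(i <- r) F i g)%R.
Proof.
move=> HF; elim: r => [|i r [c IH]].
  by have [c E] := is_form0; exists c => g; rewrite big_nil -E.
have [d E] := is_formD (HF i) (ex_intro _ c IH).
by exists d => g; rewrite big_cons -E.
Qed.

Lemma is_form_comm_monomial (r : seq I) a i m :
  is_form (fun g => commutator (\prod_(j <- r) g j ^+ a j) (g i ^+ m)).
Proof.
have [c E] := @is_form_sum r _ (fun j => is_form_comm j i (a j * m)).
exists c => g; rewrite -E.
rewrite (big_morph (commutator^~ _) (commutatorMl _) (b1l commutatorMl _)).
apply: eq_bigr => j _.
by rewrite (bXl commutatorMl) (bXr commutatorMr) -mulrnA mulnC.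
Qed.

(** Moving each power across a monomial costs only commutators of powers of
    variables, which bilinearity expands. *)
Lemma prod_expD (r : seq I) (a a' : I -> nat) : exists2 f, is_form f &
  forall g, (\prod_(i <- r) g i ^+ a i) * (\prod_(i <- r) g i ^+ a' i) =
    (\prod_(i <- r) g i ^+ (a i + a' i)) * in_group (f g).
Proof.
elim: r => [|i r [f Ff IH]].
  by exists (fun=> 0%R); [exact: is_form0|move=> g; rewrite !big_nil !mulg1].
exists (fun g => f g + commutator (\prod_(j <- r) g j ^+ a j) (g i ^+ a' i))%R.
  by apply: is_formD => //; apply: is_form_comm_monomial.
move=> g; rewrite !big_cons expgD in_groupD commutatorE.
have := IH g; set P := \prod_(j <- r) g j ^+ a j => PR.
have := class2 P (g i ^+ a' i); have := commgC P (g i ^+ a' i).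
move: [~ P, _] => K Pg KC.
rewrite -mulgA [P * _]mulgA Pg -!mulgA; congr (_ * (_ * _)).
by rewrite KC !mulgA PR.
Qed.

Definition normal_form (a : I -> nat) (f : (I -> X) -> X) :=
  exists c, forall g, f g = (\prod_i g i ^+ a i) * in_group (formT c g).

Lemma normal_formI a f q :
  is_form q -> (forall g, f g = (\prod_i g i ^+ a i) * in_group (q g)) ->
  normal_form a f.
Proof. by move=> [c E] H; exists c => g; rewrite -E. Qed.

Lemma normal_form_monomial a : normal_form a (fun g => \prod_i g i ^+ a i).
Proof. by apply: (normal_formI is_form0) => g; rewrite mulg1. Qed.

Lemma normal_form_var i : normal_form (fun k => k == i) (fun g => g i).
Proof.
apply: (normal_formI is_form0) => g; rewrite mulg1.
under eq_bigr => k _ do rewrite -[(k == i) : nat]/(if k == i then 1%N else 0%N)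
  (fun_if (fun m => g k ^+ m)) expg1 expg0.
by rewrite -big_mkcond big_pred1_eq.
Qed.

Lemma normal_formM a a' f f' : normal_form a f -> normal_form a' f' ->
  normal_form (fun i => a i + a' i)%N (fun g => f g * f' g).
Proof.
move=> [c E] [c' E']; have [q Fq Eq] := prod_expD (index_enum I) a a'.
have Ff d : is_form (formT d) by exists d.
apply: (normal_formI (is_formD Fq (is_formD (Ff c) (Ff c')))) => g.
rewrite E E' !in_groupD [RHS]mulgA -Eq -!mulgA; congr (_ * _).
by rewrite !mulgA; congr (_ * _); apply: in_groupP.
Qed.

Lemma normal_formX a f m : normal_form a f ->
  normal_form (fun i => a i * m)%N (fun g => f g ^+ m).
Proof.
move=> Ff; elim: m => [|m [c IH]].
  apply: (normal_formI is_form0) => g; rewrite mulg1 big1 // => i _.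
  by rewrite muln0.
have [d E] := normal_formM Ff (ex_intro _ c IH).
exists d => g; rewrite expgS E; congr (_ * _).
by apply: eq_bigr => i _; rewrite mulnS.
Qed.

(** Since [x^N = 1], the inverse of [x] is [x^(N-1)]. *)
Definition letter_exp (l : I * bool) : nat := if l.2 then N.-1 else 1%N.

Lemma letter_valE h l : letter_val h l = h l.1 ^+ letter_exp l.
Proof.
rewrite /letter_val /letter_exp; case: l.2; rewrite ?expg1 //.
apply: (mulgI (h l.1)); rewrite mulgV -expgS prednK ?expgN //.
by rewrite expn_gt0 prime_gt0.
Qed.

(** Stated for words in the values of a substitution [sigma], because the proof
    of [word_solutions_bound] evaluates the word at a tuple one entry of which
    is itself a product of powers of the variables. *)
Lemma normal_form_word s (sigma : I -> (I -> X) -> X) (a : I -> I -> nat) :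
    (forall i, normal_form (a i) (sigma i)) ->
  normal_form (fun k => \sum_(l <- s) a l.1 k * letter_exp l)%N
    (fun g => \prod_(l <- s) letter_val (sigma^~ g) l).
Proof.
move=> Hs; elim: s => [|l s [c IH]].
  apply: (normal_formI is_form0) => g; rewrite big_nil mulg1 big1 // => i _.
  by rewrite big_nil.
have [d E] :=
  normal_formM (normal_formX (letter_exp l) (Hs l.1)) (ex_intro _ c IH).
exists d => g; rewrite big_cons letter_valE E; congr (_ * _).
by apply: eq_bigr => i _; rewrite big_cons.
Qed.

Definition exp_sum s i := (\sum_(l <- s | l.1 == i) letter_exp l)%N.

Lemma word_shift s i0 (v : V) h :
  \prod_(l <- s)
     letter_val (fun i => if i == i0 then in_group v * h i else h i) l
  = in_group (v *+ exp_sum s i0)%R * \prod_(l <- s) letter_val h l.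
Proof.
rewrite /exp_sum; elim: s => [|l s IH]; first by rewrite !big_nil mulg1.
rewrite !big_cons IH !letter_valE; case: eqP => _.
  rewrite expgMn; last exact: in_groupP.
  rewrite mulrnDr in_groupD -!in_groupMn -!mulgA; congr (_ * _).
  by rewrite !mulgA; congr (_ * _); apply/esym/in_groupP.
by rewrite !mulgA; congr (_ * _); apply/esym/in_groupP.
Qed.

(** The variable [i0] whose exponent sum [d] divides all the others is
    restricted to the values [v u(g)], where [v] is central and [u(g)] cancels
    the exponent sums of the other variables; the resulting equation
    [d v + Q(g) = 0] falls under [comm_form_zeros] with [L v = d v]. *)
Lemma word_solutions_bound s :
  (#|X| ^ #|I| <=
     #|X| * \sum_(g : {ffun I -> X})
              ((\prod_(l <- s) letter_val g l)%g == 1%g))%N.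
Proof.
have N0 : (0 < N)%N by rewrite expn_gt0 prime_gt0.
have [i0 _ | I0] := pickP (@predT I); last first.
  have -> : s = [::] by case: s => // l; have := I0 l.1.
  rewrite (eq_bigr (fun=> 1%N)) ?sum_nat_const ?card_ffun ?muln1; last first.
    by move=> g _; rewrite big_nil eqxx.
  by rewrite leq_pmull // cardX.
have [{}i0 _ piv] := @minimal_pivot p e I predT (exp_sum s) i0 p_pr isT.
have [t Ht] := fin_all_exists (fun k => piv k isT).
(* [t k * N.-1] is [- t k] modulo [N]. *)
pose u k := if k == i0 then 0%N else (t k * N.-1)%N.
pose sigma i (g : I -> X) := if i == i0 then \prod_k g k ^+ u k else g i.
pose a i k := if i == i0 then u k else (k == i : nat).
have Hs i : normal_form (a i) (sigma i).
  rewrite /a /sigma; case: eqP => _; first exact: normal_form_monomial.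
  exact: normal_form_var.
have [c Hc] := normal_form_word s Hs.
have Hc' g : \prod_(l <- s) letter_val (sigma^~ g) l = in_group (formT c g).
  rewrite Hc big1 ?mul1g // => k _.
  have -> : (\sum_(l <- s) a l.1 k * letter_exp l =
             \sum_i a i k * exp_sum s i)%N.
    rewrite (partition_big (fun l => l.1) predT) //=; apply: eq_bigr => i _.
    by rewrite big_distrr; apply: eq_bigr => l /eqP->.
  suff /dvdnP[m ->] : N %| \sum_i a i k * exp_sum s i.
    by rewrite mulnC expgM expgN expg1n.
  rewrite (bigD1 i0) //= {1}/a eqxx /u; case: (eqVneq k i0) => [->|ki].
    rewrite big1 // => i /negPf ii0; by rewrite /a ii0 eq_sym ii0.
  rewrite (bigD1 k) //= big1 ?addn0; last first.
    move=> i /andP[/negPf ii0 /negPf ik]; by rewrite /a ii0 eq_sym ik.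
  rewrite /a (negPf ki) eqxx mul1n.
  rewrite /dvdn -modnDmr Ht modnDmr.
  rewrite -[(t k * exp_sum s i0)%N]muln1 mulnAC -mulnDr addn1 prednK //.
  by rewrite modnMl.
have V0 : (0 < #|V|)%N by apply/card_gt0P; exists 0%R.
have := @comm_form_zeros I X V commutator commutatorMl commutatorxx
  commutatorMr p e p_pr V_expN [set: I] c V (fun v => v *+ exp_sum s i0)%R.
rewrite leq_pmul2l // => H; apply: leq_trans (H _) _ => [v w|].
  exact: mulrnDl.
rewrite exchange_big -(sum_update i0) /=; apply: leq_sum => g _.
pose x (v : V) := in_group v * \prod_k g k ^+ u k.
have x_inj : injective x by move=> v w /mulIg/in_group_inj.
(* Only the values [x v] of the redrawn coordinate are kept. *)
rewrite [leqRHS](bigID (mem (x @: [set: V]))) /= -[leqLHS]addn0 leq_add //.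
rewrite big_imset /=; last by move=> v w _ _; apply: x_inj.
rewrite [leqRHS](eq_bigl predT) => [|v]; last by rewrite inE.
apply: leq_sum => v _.
rewrite (_ : \prod_(l <- s) _ = in_group (v *+ exp_sum s i0 + formT c g)%R).
  by rewrite (inj_eq (@in_group_inj _) _ 0%R).
rewrite in_groupD -Hc' -word_shift; apply: eq_bigr => l _; rewrite /x.
rewrite !letter_valE; congr (_ ^+ _); rewrite ffunE /sigma.
by case: eqP.
Qed.

End Words.

(** * Solutions of a word *)

Theorem theorem1p4 (p : nat) (gT : finGroupType) (G : {group gT})
    (n : nat) (w : free_group 'I_n) :
  prime p -> (p.-group G)%g -> nil_class G = 2 ->
  ((#|G|%:R)^-1 <= word_prob G w)%R.
Proof.
move=> p_pr pG cl2; have [e cardG] := p_natP pG.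
pose X : finGroupType := subg_of G.
have cardX : #|X| = #|G| by rewrite card_sub.
have class2 (x y z : X) : commute [~ x, y]%g z.
  have /subsetP sub : (G^`(1) \subset 'Z(G))%g by rewrite -nil_class2 cl2.
  have /centerP[_ cG] := sub _ (mem_commg (subgP x) (subgP y)).
  by apply: val_inj; apply: cG; apply: subgP.
have := word_solutions_bound class2 p_pr (etrans cardX cardG) (word w).
rewrite card_ord cardX => bound.
have le_sols : (\sum_(g : {ffun 'I_n -> X})
    (\prod_(l <- word w) letter_val g l == 1)%g <= #|word_sols G w|)%N.
  pose F (g : {ffun 'I_n -> X}) : {ffun 'I_n -> gT} := [ffun i => sgval (g i)].
  have F_inj : injective F.
    move=> g h /ffunP E; apply/ffunP=> i; have := E i.
    by rewrite !ffunE => /val_inj.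
  rewrite (eq_bigr (fun g : {ffun 'I_n -> X} =>
    if word_val g w == 1%g then 1%N else 0%N)); last first.
    by move=> g _; rewrite /word_val; case: eqP.
  rewrite -big_mkcond sum1_card -(card_imset _ F_inj) subset_leq_card //.
  apply/subsetP=> _ /imsetP[g g1 ->]; rewrite inE; apply/andP; split.
    by apply/ffun_onP=> i; rewrite ffunE; apply: subgP.
  have <- : sgval (word_val g w) = word_val (F g) w.
    rewrite /word_val (big_morph (sgval : X -> gT)
      (id1 := 1%g) (op1 := fun x y => (x * y)%g)) //.
    apply: eq_bigr => l _; rewrite /letter_val ffunE; by case: l.2.
  by move: g1; rewrite unfold_in => /eqP->.
have G0 : (0 < #|G|%:R :> rat)%R by rewrite ltr0n cardG_gt0.
rewrite /word_prob ler_pdivlMr ?exprn_gt0 // mulrC ler_pdivrMr //.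
rewrite -natrX -natrM ler_nat mulnC.
by apply: leq_trans bound _; rewrite leq_mul2l le_sols orbT.
Qed.
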